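(* Let $G$ be an infinite, finitely generated group with finite symmetric generating set $S$ and edge lengths $l$, and let $(Z_n)_{n\in\mathbb{N}_0}=((\eta_n,X_n))_{n\in\mathbb{N}_0}$ be a lamplighter random walk on $\mathcal{L}=\mathbb{Z}_2\wr G$ as described in the context, whose projection $(X_n)_{n\in\mathbb{N}_0}$ onto $G$ is transient. Then $$\ell_{\mathrm{supp}}=\lim_{n\to\infty}\frac{|\mathrm{supp}(\eta_n)|}{n}>0 .$$ Moreover, if $c_{\mathcal{L}}>0$, then $\ell>\ell_0$.
   Context: $G$ is an infinite group with identity $e$; $S\subseteq G\setminus\{e\}$ is a finite symmetric set generating $G$ as a semigroup. Each $s\in S$ has a length $l(s)=l(s^{-1})>0$. The metric on $G$ is $d(x,y)=\min\{\sum_{i=1}^n l(s_i) : s_1,\dots,s_n\in S,\ y=xs_1\cdots s_n\}$. A path in $G$ is a finite sequence $[x_0,\dots,x_n]$ with $x_{i-1}^{-1}x_i\in S$; its length is $\sum_i l(x_{i-1}^{-1}x_i)$. $\mathbb{Z}_2=\mathbb{Z}/2\mathbb{Z}$; $\mathcal{N}$ is the set of finitely supported $\eta:G\to\mathbb{Z}_2$; $\mathbf{0}$ is the zero configuration. $\mathcal{L}=\mathbb{Z}_2\wr G$ is $\mathcal{N}\times G$ with product $(\eta_1,x)(\eta_2,y)=(\eta_1\oplus x\eta_2,xy)$, where $(x\eta)(w)=\eta(x^{-1}w)$ and $\oplus$ is componentwise addition mod 2. $d_{\mathrm{TS}}(\eta,x)$ is the minimal length of a path in $G$ from $e$ to $x$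 that visits every $y\in\mathrm{supp}(\eta)$. With a fixed constant $c_{\mathcal{L}}\ge 0$, $\ell(\eta,x):=d_{\mathrm{TS}}(\eta,x)+c_{\mathcal{L}}\,|\mathrm{supp}(\eta)|$. Lamplighter random walk: $(\mathbf{i}_n)_{n\ge1}$ are i.i.d. $\mathcal{L}$-valued with law $\mu$, $Z_0=(\mathbf{0},e)$, $Z_n=Z_{n-1}\mathbf{i}_n$, $Z_n=(\eta_n,X_n)$. Assumptions: $(Z_n)$ is irreducible (every element of $\mathcal{L}$ is reached from every other with positive probability) and transient, and (1) $\langle\mathrm{supp}(\mu)\rangle=\mathcal{L}$; (2) there is $R\ge0$ such that $\mu(\eta,x)>0$ implies $d(e,y)\le R$ for all $y\in\mathrm{supp}(\eta)$; (3) $\sum_{(\eta,x)\in\mathcal{L}}d(e,x)\mu(\eta,x)<\infty$. The projection $(X_n)$ is assumed transient. The following limits exist almost surely and are constant (Kingman's subadditive ergodic theorem): $\ell_0=\lim_n d(e,X_n)/n$, $\ell=\lim_n \ell(Z_n)/n$, $\ell_{\mathrm{supp}}=\lim_n|\mathrm{supp}(\eta_n)|/n$. *)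

(* Defs.v *)
From HB Require Import structures.
From mathcomp Require Import all_boot all_order all_algebra finmap.
From mathcomp Require Import all_classical all_reals all_analysis.

Set Implicit Arguments.
Unset Strict Implicit.
Unset Printing Implicit Defensive.

Import Order.TTheory GRing.Theory Num.Theory numFieldNormedType.Exports.

Local Open Scope classical_set_scope.
Local Open Scope ring_scope.

Notation config G := {fsfun G -> 'Z_2 with 0%R}.

Section Config.
Variable G : groupType.
Implicit Types (f g h : config G) (x y w : G).

Definition config0 : config G := [fsfun].

Definition config_add f g : config G :=
  [fsfun w in (finsupp f `|` finsupp g)%fset => f w + g w].

Definition config_shift x f : config G :=
  [fsfun w in [fset (x * y)%g | y in finsupp f]%fset => f (x^-1 * w)%g].

Lemma config0E w : config0 w = 0.
Proof. by rewrite /config0 fsfunE. Qed.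

Lemma config_addE f g w : config_add f g w = f w + g w.
Proof.
rewrite /config_add fsfunE; case: ifPn => //.
rewrite inE negb_or => /andP[wf wg].
by rewrite (fsfun_dflt wf) (fsfun_dflt wg) addr0.
Qed.

Lemma config_shiftE x f w : config_shift x f w = f (x^-1 * w)%g.
Proof.
rewrite /config_shift fsfunE; case: ifPn => // /negP wx.
rewrite fsfun_dflt//; apply/negP => xw; apply: wx.
by apply/imfsetP; exists (x^-1 * w)%g => //; rewrite mulgA mulgV mul1g.
Qed.

End Config.

(* An alias, so that the product below is not confused with the library's
   direct product of groups. *)
Definition lamplighter (G : groupType) : Type := (config G * G)%type.
HB.instance Definition _ (G : groupType) := Choice.on (lamplighter G).

Section Lamplighter.
Variable G : groupType.
Implicit Types u v w : lamplighter G.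

Definition lmul u v : lamplighter G :=
  (config_add u.1 (config_shift u.2 v.1), (u.2 * v.2)%g).

Definition lone : lamplighter G := (config0 G, 1%g).

(* In 'Z_2 every element is its own opposite. *)
Definition linv u : lamplighter G := (config_shift u.2^-1%g u.1, u.2^-1%g).

Let addZ2 (a : 'Z_2) : a + a = 0.
Proof. by apply/val_inj; case: a => [[|[|[]]]]. Qed.

Let lmulA : associative lmul.
Proof.
move=> [f x] [g y] [h z]; congr pair => /=; last exact: mulgA.
by apply/fsfunP => w; rewrite !(config_addE, config_shiftE) invgM mulgA addrA.
Qed.

Let lmul1 : left_id lone lmul.
Proof.
move=> [f x]; congr pair => /=; last exact: mul1g.
apply/fsfunP => w.
by rewrite !(config_addE, config_shiftE) config0E add0r invg1 mul1g.
Qed.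

Let lmulr1 : right_id lone lmul.
Proof.
move=> [f x]; congr pair => /=; last exact: mulg1.
by apply/fsfunP => w; rewrite !(config_addE, config_shiftE) config0E addr0.
Qed.

Let lmulV : left_inverse lone linv lmul.
Proof.
move=> [f x]; congr pair => /=; last exact: mulVg.
by apply/fsfunP => w; rewrite !(config_addE, config_shiftE) config0E addZ2.
Qed.

Let lmulrV : right_inverse lone linv lmul.
Proof.
move=> [f x]; congr pair => /=; last exact: mulgV.
apply/fsfunP => w; rewrite !(config_addE, config_shiftE) config0E invgK.
by rewrite mulgA mulgV mul1g addZ2.
Qed.

HB.instance Definition _ :=
  isGroup.Build (lamplighter G) lmulA lmul1 lmulr1 lmulV lmulrV.

HB.instance Definition _ := isPointed.Build (lamplighter G) lone.

(* [lamplighter G] is countable when [G] is finitely generated, and carries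
   the discrete sigma-algebra. *)
HB.instance Definition _ := @isMeasurable.Build default_measure_display
  (lamplighter G) discrete_measurable discrete_measurable0
  discrete_measurableC discrete_measurableU.

End Lamplighter.

Section Lengths.
Variables (R : realType) (G : groupType) (S : {fset G}) (l : G -> R).
Implicit Types (x y : G) (s p : seq G).

Definition generates_as_semigroup :=
  forall x, exists s, [/\ s != [::], {subset s <= S} & x = (\prod_(a <- s) a)%g].

Definition wlen s : R := \sum_(a <- s) l a.

(* Under the standing assumptions the infima [dist] and [dTS] are minima: see
   [distP] and [dTSP] below. *)
Definition dist x y : R := inf
  [set wlen s | s in [set s | {subset s <= S} /\ y = (x * \prod_(a <- s) a)%g]].

(* The path [x0, ..., xn] is represented by [x0] and [p := [:: x1; ...; xn]]. *)
Definition steps x0 p : seq G := pairmap (fun x y => x^-1 * y)%g x0 p.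

Definition is_path x0 p := path (fun x y => (x^-1 * y)%g \in S) x0 p.

Definition path_len x0 p : R := wlen (steps x0 p).

Definition dTS (z : lamplighter G) : R := inf
  [set path_len 1%g p | p in [set p | [/\ is_path 1%g p, last 1%g p = z.2
                                        & {subset finsupp z.1 <= 1%g :: p}]]].

Definition ell_length (c : R) (z : lamplighter G) : R :=
  dTS z + c * #|` finsupp z.1|%:R.

End Lengths.

Section Probability.
Variables (d : measure_display) (Omega : measurableType d) (R : realType).
Variable P : probability Omega R.

Section Independence.
Variables (d' : measure_display) (T : measurableType d').
Implicit Type X : nat -> {RV P >-> T}.

Definition mutually_independent X :=
  forall (J : {fset nat}) (A : nat -> set T), (forall j, measurable (A j)) ->
    P (\bigcap_(j in [set` J]) (X j @^-1` A j)) =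
    (\prod_(j <- J) P (X j @^-1` A j))%E.

Definition iid X (mu : probability T R) :=
  mutually_independent X /\
  forall n A, measurable A -> distribution P (X n) A = mu A.

End Independence.

(* [walk X n = X 0 * ... * X (n - 1)]: the increments are indexed from 0. *)
Fixpoint walk (H : groupType) (X : nat -> Omega -> H) (n : nat) (w : Omega) : H
  := if n is m.+1 then (walk X m w * X m w)%g else 1%g.

(* [x * W n] is the walk [W] started at [x] instead of 1. *)
Definition irreducible (H : groupType) (W : nat -> Omega -> H) :=
  forall x y : H, exists n, (0 < P [set w | (x * W n w)%g = y])%E.

Definition transient (H : Type) (W : nat -> Omega -> H) :=
  forall x : H, {ae P, forall w, \forall n \near \oo, W n w <> x}.

Definition as_limit (U : nat -> Omega -> R) (a : R) :=
  {ae P, forall w, (fun n => U n w) @ \oo --> a}.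

End Probability.

Definition mass_support (d : measure_display) (T : measurableType d)
    (R : realType) (mu : probability T R) : set T :=
  [set z | (0 < mu [set z])%E].

Definition is_subgroup (H : groupType) (K : set H) :=
  K 1%g /\ forall x y, K x -> K y -> K (x * y^-1)%g.

Definition generated_subgroup (H : groupType) (A : set H) : set H :=
  smallest (@is_subgroup H) A.

Section Minima.
Variables (R : realType) (G : groupType) (S : {fset G}) (l : G -> R).
Hypothesis l_gt0 : forall s, s \in S -> 0 < l s.
Implicit Types (A : set (seq G)) (s p : seq G).

Let seq_min (T : eqType) (f : T -> R) (r : seq T) (x0 : T) : x0 \in r ->
  exists2 x, x \in r & forall y, y \in r -> f x <= f y.
Proof.
elim: r x0 => // a r IHr x0 _; case: r IHr => [|b r] IHr.
  by exists a; rewrite ?mem_head// => y; rewrite inE => /eqP->.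
have [x xr xmin] := IHr b (mem_head _ _).
have [ax|/ltW xa] := leP (f a) (f x).
  exists a; first exact: mem_head.
  by move=> y; rewrite inE => /predU1P[->//|/xmin]; exact: le_trans.
exists x; first by rewrite inE xr orbT.
by move=> y; rewrite inE => /predU1P[->//|/xmin].
Qed.

Let wlen_size_bound :
  exists2 e : R, 0 < e & forall s, {subset s <= S} -> e * (size s)%:R <= wlen l s.
Proof.
have [e e0 le_e] : exists2 e : R, 0 < e & forall a, a \in S -> e <= l a.
  have: {subset enum_fset S <= S} by [].
  suff H (r : seq G) : {subset r <= S} ->
      exists2 e : R, 0 < e & forall a, a \in r -> e <= l a by exact: H.
  elim: r => [_|a r IHr sS]; first by exists 1.
  have [|e e0 le_e] := IHr; first by move=> x xr; rewrite sS// inE xr orbT.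
  have la : 0 < l a by rewrite l_gt0// sS// mem_head.
  exists (Num.min e (l a)); first by rewrite lt_min e0.
  by move=> x; rewrite inE => /predU1P[->|/le_e xe]; rewrite ge_min ?lexx ?orbT// xe.
exists e => // s sS; rewrite /wlen -sum1_size natr_sum mulr_sumr.
by rewrite big_seq [leRHS]big_seq ler_sum// => a /sS /le_e; rewrite mulr1.
Qed.

Let wlen_ge0 s : {subset s <= S} -> 0 <= wlen l s.
Proof.
by move=> sS; rewrite /wlen big_seq sumr_ge0// => a /sS /l_gt0 /ltW.
Qed.

(* Only finitely many words on [S] are no longer than a given one. *)
Let words_finite (N : nat) :
  finite_set [set s : seq G | {subset s <= S} /\ (size s <= N)%N].
Proof.
elim: N => [|N IHN].
  by apply: sub_finite_set (finite_set1 [::]) => s /= [_]; rewrite leqn0 size_eq0 => /eqP.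
have fS : finite_set [set` S] by exact: finite_fset.
have : finite_set ([set [::]] `|`
    [set a :: s | a in [set` S] & s in
      [set s : seq G | {subset s <= S} /\ (size s <= N)%N]]).
  by rewrite finite_setU; split; [exact: finite_set1|exact: finite_image2].
apply: sub_finite_set => -[|a s] /= [sS sN]; first by left.
right; exists a; first by rewrite /= sS// mem_head.
by exists s => //; split=> // x xs; rewrite sS// inE xs orbT.
Qed.

Lemma wlen_min A : A !=set0 -> (forall s, A s -> {subset s <= S}) ->
  exists2 s, A s & forall s', A s' -> wlen l s <= wlen l s'.
Proof.
move=> [s0 As0] AS; have [e e0 le_e] := wlen_size_bound.
pose N := Num.truncn (wlen l s0 / e).
have szN s : A s -> wlen l s <= wlen l s0 -> (size s <= N)%N.
  move=> As ss0; rewrite /N truncn_ge_nat; last first.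
    by rewrite divr_ge0 ?wlen_ge0 ?(ltW e0)//; exact: AS.
  by rewrite ler_pdivlMr// mulrC (le_trans (le_e _ (AS _ As))).
have : finite_set [set s | A s /\ wlen l s <= wlen l s0].
  apply: sub_finite_set (words_finite N) => s /= [As ss0].
  by split; [exact: AS|exact: szN].
move=> /finite_seqP[r rE].
have memr s : (s \in r) = `[< A s /\ wlen l s <= wlen l s0 >].
  apply/idP/asboolP => [sr|sA]; first by have : [set` r] s by []; rewrite -rE.
  by have : [set` r] s by rewrite -rE.
have s0r : s0 \in r by rewrite memr; apply/asboolP.
have [s sr smin] := seq_min (wlen l) s0r.
move: (sr); rewrite memr => /asboolP[As ss0]; exists s => // s' As'.
have [s's0|/ltW s0s'] := leP (wlen l s') (wlen l s0).
  by apply: smin; rewrite memr; apply/asboolP.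
exact: le_trans ss0 s0s'.
Qed.

Let inf_wlen A : A !=set0 -> (forall s, A s -> {subset s <= S}) ->
  exists2 s, A s & wlen l s = inf [set wlen l s | s in A] /\
    forall s', A s' -> wlen l s <= wlen l s'.
Proof.
move=> A0 AS; have [s As smin] := wlen_min A0 AS; exists s => //; split=> //.
apply/eqP; rewrite eq_le; apply/andP; split.
  apply: lb_le_inf; first by exists (wlen l s); exists s.
  by move=> _ [s' As' <-]; exact: smin.
by apply: ge_inf; [exists (wlen l s) => _ [s' As' <-]; exact: smin|exists s].
Qed.

Hypothesis S_gen : generates_as_semigroup S.

Lemma distP x y : exists s,
  [/\ {subset s <= S}, y = (x * \prod_(a <- s) a)%g, wlen l s = dist S l x y &
   forall s', {subset s' <= S} -> y = (x * \prod_(a <- s') a)%g ->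
     dist S l x y <= wlen l s'].
Proof.
have [||s [sS ys] []] := @inf_wlen
    [set s | {subset s <= S} /\ y = (x * \prod_(a <- s) a)%g].
- by have [s [_ sS xy]] := S_gen (x^-1 * y)%g; exists s; rewrite /= -xy mulVKg.
- by move=> s [].
rewrite -/(dist S l x y) => dE smin.
by exists s; split=> // s' s'S ys'; rewrite -dE; apply: smin.
Qed.

Let is_pathE x0 p : is_path S x0 p = all (mem S) (steps x0 p).
Proof. by elim: p x0 => //= x p IHp x0; rewrite -IHp. Qed.

Let path_to x y : exists2 p, is_path S x p & last x p = y.
Proof.
have [s [_ sS xy]] := S_gen (x^-1 * y)%g.
exists (scanl (fun a b => a * b)%g x s).
  rewrite is_pathE /steps scanlK; first exact/allP.
  by move=> a b; rewrite mulKg.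
have -> : y = (x * \prod_(a <- s) a)%g by rewrite -xy mulVKg.
elim: s x {sS xy} => [|a s IHs] x /=; first by rewrite big_nil mulg1.
by rewrite IHs big_cons mulgA.
Qed.

Let tour_exists x0 y (r : seq G) : exists p,
  [/\ is_path S x0 p, last x0 p = y & {subset r <= x0 :: p}].
Proof.
elim: r x0 => [|a r IHr] x0.
  by have [p px py] := path_to x0 y; exists p.
have [p px pa] := path_to x0 a; have [q [qa qy rq]] := IHr a.
exists (p ++ q); split.
- by rewrite /is_path cat_path pa; apply/andP.
- by rewrite last_cat pa.
have ap : a \in x0 :: p by rewrite -pa mem_last.
move=> b; rewrite -cat_cons mem_cat inE => /predU1P[->|/rq]; first by rewrite ap.
by rewrite inE => /predU1P[->|->]; rewrite ?ap ?orbT.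
Qed.

Lemma dTSP (z : lamplighter G) : exists p,
  [/\ is_path S 1%g p, last 1%g p = z.2, {subset finsupp z.1 <= 1%g :: p} &
   path_len l 1%g p = dTS S l z] /\
  forall q, is_path S 1%g q -> last 1%g q = z.2 ->
    {subset finsupp z.1 <= 1%g :: q} -> dTS S l z <= path_len l 1%g q.
Proof.
pose B := [set p | [/\ is_path S 1%g p, last 1%g p = z.2
                     & {subset finsupp z.1 <= 1%g :: p}]].
have [||_ [p Bp <-] []] := @inf_wlen [set steps 1%g p | p in B].
- have [p pz] := tour_exists 1%g z.2 (finsupp z.1).
  by exists (steps 1%g p); exists p.
- by move=> _ [p [pS _ _] <-]; apply/allP; rewrite -is_pathE.
rewrite image_comp -/(dTS S l z) => plen pmin; exists p; case: (Bp) => pS pz zp.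
split=> // q qS qz zq; rewrite -plen; apply: pmin.
by exists q.
Qed.

End Minima.

(* Main.v *)
Require Import Defs.
From mathcomp Require Import all_boot all_order all_algebra finmap.
From mathcomp Require Import all_classical all_reals all_analysis.
From mathcomp Require Import measurable_realfun.

Set Implicit Arguments.
Unset Strict Implicit.
Unset Printing Implicit Defensive.

Import Order.TTheory GRing.Theory Num.Theory numFieldNormedType.Exports.

Local Open Scope classical_set_scope.
Local Open Scope ring_scope.

(** The first claim rests on fair lamp flips that stay visible for ever.

    By irreducibility some word [sa] of increments multiplies to the element
    that only switches the lamp at the identity, and some word [sg] multiplies
    to a pure displacement by [g <> 1]. The words [sa ++ sg] and [sg ++ sa]
    have the same length, the same probability [q > 0] and the same
    displacement [g], but the first one switches the lamp at its starting point
    and the second one does not ([fair_lamp_flip]). So, whenever the walk reads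
    one of these two words from time [t] on, the final state of the lamp at the
    position at time [t] is decided by a fair coin, independent of the
    increments outside the word: whatever those are, exactly one of the two
    words leaves the lamp on.

    For a linear lower bound the lamps in question must be at distinct places.
    After the word the walker stands at [g] relative to the lamp, and hits the
    lamp again when the subsequent displacement is [g^-1]. By transience there
    is a [k] such that with probability at least 1/2 this does not happen from
    time [k] on ([escape_time]). If the attempts start at the multiples of
    [K = m + k], where [m] is the length of the words, then the successful
    attempts that are never revisited take place at pairwise distinct sites
    ([lasting_flip_last]), so the number of lamps on at time [M * K] is at least
    the number of successes among [M] attempts ([count_lasting_flip]), each of
    which has probability at least [q / 2] ([prob_lasting_flip]). By dominated
    convergence, the frequency of events whose probabilities are bounded below
    cannot tend to 0 almost surely ([frequent_events_limit_gt0]).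

    The second claim follows, as a tour that ends at [x] is at least as long as
    the distance to [x] ([dist_le_dTS]): in the limit, [ell0 + c * ell_supp] is
    at most [ell]. *)

Local Notation word_prod s := (\prod_(a <- s) a)%g.

(** * Countability of the lamplighter group *)

Lemma countable_inj (T U : Type) (f : T -> U) :
  injective f -> countable [set: U] -> countable [set: T].
Proof.
move=> finj /countable_injP[h hinj]; apply/countable_injP; exists (h \o f).
by move=> x y _ _ /hinj hxy; apply: finj; apply: hxy; rewrite inE.
Qed.

Lemma countable_seq (T : Type) : countable [set: T] -> countable [set: seq T].
Proof.
move=> /countable_injP[f finj]; apply: (@countable_inj _ (seq nat) (map f)).
  by apply: inj_map => x y; apply: finj; rewrite inE.
exact: countableP.
Qed.

Lemma countable_config (G : groupType) :
  countable [set: G] -> countable [set: config G].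
Proof.
move=> cG.
(* A configuration with values in a two-element ring is its support. *)
apply: (@countable_inj _ (seq G) (fun f : config G => finsupp f));
  last exact: countable_seq.
have Z2 (a : 'Z_2) : a != 0 -> a = 1.
  by case: a => [[|[|[]]]]// ? _; apply: val_inj.
move=> f g fg; apply/fsfunP => x.
have E : (x \in finsupp f) = (x \in finsupp g).
  by rewrite [LHS](_ : _ = (x \in (finsupp f : seq G)))// fg.
move: E; rewrite !mem_finsupp; have [->|/Z2->] := eqVneq (f x) 0.
  by move/esym/negbFE/eqP.
by move/esym/Z2.
Qed.

Lemma countable_lamplighter (G : groupType) (S : {fset G}) :
  generates_as_semigroup S -> countable [set: lamplighter G].
Proof.
move=> S_gen; have cG : countable [set: G].
  have /sub_countable : ([set: G] #<= [set: seq S])%card.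
    apply: (card_le_trans (B := range (fun s : seq S => \prod_(a <- s) val a)%g));
      last exact: card_image_le.
    apply: subset_card_le => x _; have [s [_ sS ->]] := S_gen x.
    have [t ->] : exists t : seq S, s = map val t.
      elim: s sS => [|a s IHs] sS; first by exists [::].
      have [b bs|t ->] := IHs; first by rewrite sS// inE bs orbT.
      by exists ([` sS a (mem_head _ _)]%fset :: t).
    by exists t => //; rewrite big_map.
  by apply; apply: countableP.
have := countableX (countable_config cG) cG.
by rewrite setXTT.
Qed.

(** * Laws on countable types *)

Section AtomicLaws.
Context d (Omega : measurableType d) (R : realType) (P : probability Omega R).
Variables (T : Type) (T_countable : countable [set: T]).

Lemma measurable_countable_fibers (V : Omega -> T) (A : set T) :
  (forall s, measurable (V @^-1` [set s])) -> measurable (V @^-1` A).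
Proof.
move=> mV; have [f finj] := countable_injP _ T_countable.
rewrite (_ : V @^-1` A = \bigcup_n (V @^-1` (A `&` f @^-1` [set n]))); last first.
  by apply/seteqP; split => [w Aw|w [n _ []]//]; exists (f (V w)).
apply: bigcup_measurable => n _.
have [[s [As fs]]|nex] := pselect (exists s, A s /\ f s = n).
  rewrite (_ : _ `&` _ = [set s])//; apply/seteqP; split => [t [At /= ft]|t ->//].
  by apply: finj; rewrite ?inE// fs.
rewrite (_ : A `&` f @^-1` [set n] = set0) ?preimage_set0//.
apply/seteqP; split => // s [As fs].
by apply: nex; exists s.
Qed.

(** On a countable type a measure is the sum of its atoms, so a proportionality
    of two laws can be checked on atoms. With [B] the full event and [k = 1]
    this gives equality of laws; with [V = V'] and [k = P B] it gives
    independence of [V] from [B]. *)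
Lemma atomic_law_scale (V V' : Omega -> T) (B : set Omega) (k : R) :
  measurable B ->
  (forall s, measurable (V @^-1` [set s])) ->
  (forall s, measurable (V' @^-1` [set s])) ->
  (forall s, P (B `&` V @^-1` [set s]) = k%:E * P (V' @^-1` [set s]))%E ->
  forall A, (P (B `&` V @^-1` A) = k%:E * P (V' @^-1` A))%E.
Proof.
move=> mB mV mV' VV' A; have [f finj] := countable_injP _ T_countable.
pose A_ n := A `&` f @^-1` [set n].
have split_A (W : Omega -> T) (C : set Omega) : measurable C ->
    (forall s, measurable (W @^-1` [set s])) ->
    (P (C `&` W @^-1` A) = \sum_(n <oo) P (C `&` W @^-1` A_ n))%E.
  move=> mC mW; rewrite (_ : C `&` W @^-1` A = \bigcup_n (C `&` W @^-1` A_ n)); last first.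
    apply/seteqP; split => [w [Cw Aw]|w [n _ [Cw []]]//].
    by exists (f (W w)).
  rewrite measure_bigcup//.
  - by apply: eq_eseriesl => n; rewrite /= in_setT.
  - by move=> n _; apply: measurableI => //; exact: measurable_countable_fibers.
  - by move=> i j _ _ [w [[_ [_ <-]] [_ [_ <-]]]].
have -> : V' @^-1` A = setT `&` V' @^-1` A by rewrite setTI.
rewrite !split_A// -nneseriesZl//; apply: eq_eseriesr => n _; rewrite setTI.
have [[s [As fs]]|nex] := pselect (exists s, A s /\ f s = n).
  rewrite (_ : A_ n = [set s])//; apply/seteqP; split => [t [At /= ft]|t ->//].
  by apply: finj; rewrite ?inE// fs.
rewrite (_ : A_ n = set0); first by rewrite !preimage_set0 setI0 measure0 mule0.
by apply/seteqP; split => // s [As fs]; apply: nex; exists s.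
Qed.

End AtomicLaws.

(** * The law of finitely many increments *)

Section Increments.
Context d (Omega : measurableType d) (R : realType) (P : probability Omega R).
Variables (G : groupType) (mu : probability (lamplighter G) R).
Variable incr : nat -> {RV P >-> lamplighter G}.
Hypothesis incr_iid : iid incr mu.
Hypothesis L_countable : countable [set: lamplighter G].
Implicit Types (J : seq nat) (s : seq (lamplighter G)).

Definition incr_at J (w : Omega) : seq (lamplighter G) :=
  [seq incr j w | j <- J].

Definition word_prob s : R := \prod_(z <- s) fine (mu [set z]).

(** A word has probability equal to the product of the probabilities of its
    letters. This is mutual independence, with the [j]-th event prescribing the
    letter at the place of [j] in [J]; distinct indices are required since a
    repeated index would be counted twice. *)
Lemma incr_at_fiber J s : uniq J -> size s = size J ->
  measurable (incr_at J @^-1` [set s]) /\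
  P (incr_at J @^-1` [set s]) = (word_prob s)%:E.
Proof.
move=> uJ sJ; pose A j : set (lamplighter G) := [set nth 1%g s (index j J)].
have mA j : measurable (A j) by [].
have fiberE : incr_at J @^-1` [set s] =
    \bigcap_(j in [set` [fset j | j in J]%fset]) (incr j @^-1` A j).
  apply/seteqP; split => w /=.
    move=> ws j /=; rewrite !inE /= => jJ.
    by rewrite /A /= -ws (nth_map 0%N) ?index_mem// nth_index.
  move=> ws; apply: (@eq_from_nth _ 1%g); rewrite size_map// => i iJ.
  rewrite (nth_map 0%N)//; have := ws (nth 0%N J i).
  by rewrite /= !inE mem_nth// /A /= index_uniq//; apply.
split.
  rewrite fiberE; apply: fin_bigcap_measurable; first exact: finite_fset.
  by move=> j _; rewrite -[_ @^-1` _]setTI; apply: measurable_funP.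
have [indep law] := incr_iid.
rewrite fiberE indep// /word_prob.
rewrite (eq_bigr (fun j => (fine (mu (A j)))%:E)); last first.
  by move=> j _; rewrite fineK ?fin_num_measure// -(law j).
rewrite prodEFin; congr EFin; rewrite (perm_big J) /=; last first.
  by apply: uniq_perm; rewrite ?fset_uniq// => j; rewrite !inE.
rewrite [RHS](big_nth 1%g) sJ [LHS](big_nth 0%N).
by apply: eq_big_nat => i /andP[_ iJ]; rewrite /A index_uniq.
Qed.

Lemma incr_at_fiber0 J s : size s <> size J -> incr_at J @^-1` [set s] = set0.
Proof.
by move=> sJ; apply/seteqP; split => // w /= ws; apply: sJ; rewrite -ws size_map.
Qed.

Lemma measurable_incr_at J (A : set (seq (lamplighter G))) :
  uniq J -> measurable (incr_at J @^-1` A).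
Proof.
move=> uJ; apply: measurable_countable_fibers; first exact: countable_seq.
move=> s; have [sJ|/eqP sJ] := eqVneq (size s) (size J).
  by have [] := incr_at_fiber uJ sJ.
by rewrite incr_at_fiber0.
Qed.

(** Stationarity: the increments are identically distributed, so only the
    number of indices matters. *)
Lemma incr_at_shift J J' (A : set (seq (lamplighter G))) :
  uniq J -> uniq J' -> size J = size J' ->
  P (incr_at J @^-1` A) = P (incr_at J' @^-1` A).
Proof.
move=> uJ uJ' JJ'; rewrite -[incr_at J @^-1` A]setTI -[RHS]mul1e.
apply: atomic_law_scale => //; first exact: countable_seq.
- by move=> s; exact: measurable_incr_at.
- by move=> s; exact: measurable_incr_at.
move=> s; rewrite setTI mul1e.
have [sJ|/eqP sJ] := eqVneq (size s) (size J).
  have [_ ->] := incr_at_fiber uJ sJ.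
  by have [_ ->] := incr_at_fiber uJ' (etrans sJ JJ').
by rewrite !incr_at_fiber0 -?JJ'.
Qed.

Lemma word_prob_cat s s' : word_prob (s ++ s') = word_prob s * word_prob s'.
Proof. by rewrite /word_prob big_cat. Qed.

Lemma incr_at_indep J J' s (A : set (seq (lamplighter G))) :
  uniq (J ++ J') -> size s = size J ->
  (P (incr_at J @^-1` [set s] `&` incr_at J' @^-1` A) =
    (word_prob s)%:E * P (incr_at J' @^-1` A))%E.
Proof.
move=> uJJ' sJ; have [uJ _ uJ'] : [/\ uniq J, ~~ has (mem J) J' & uniq J'].
  by apply/and3P; rewrite -cat_uniq.
apply: atomic_law_scale; first exact: countable_seq.
- exact: measurable_incr_at.
- by move=> ?; exact: measurable_incr_at.
- by move=> ?; exact: measurable_incr_at.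
move=> s'; have [s'J'|/eqP s'J'] := eqVneq (size s') (size J'); last first.
  by rewrite (incr_at_fiber0 s'J') setI0 measure0 mule0.
have [_ ->] := incr_at_fiber uJ' s'J'; rewrite -EFinM -word_prob_cat.
have [|_ <-] := incr_at_fiber (s := s ++ s') uJJ'; first by rewrite !size_cat sJ s'J'.
congr (P _); apply/seteqP; split => w /=.
  by move=> [<- <-]; rewrite /incr_at map_cat.
move/eqP; rewrite /incr_at map_cat eqseq_cat ?size_map ?sJ//.
by move=> /andP[/eqP ? /eqP ?].
Qed.

Lemma walkE n w : walk incr n w = word_prod (incr_at (iota 0 n) w).
Proof.
elim: n => [|n IHn]; first by rewrite /= big_nil.
by rewrite [LHS]/= IHn -[in RHS]addn1 iotaD /incr_at map_cat big_cat /= big_seq1.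
Qed.

(** Only countably many words multiply to [z]; if all of them had probability
    0, then [z] would be reached with probability 0. *)
Lemma word_prob_gt0 z : irreducible P (walk incr) ->
  exists s, word_prod s = z /\ 0 < word_prob s.
Proof.
move=> /(_ 1%g z)[n]; apply: contraPP => nex; apply/negP; rewrite -leNgt.
pose A := [set s : seq (lamplighter G) | word_prod s = z].
rewrite (_ : [set w | _] = setT `&` incr_at (iota 0 n) @^-1` A); last first.
  by apply/seteqP; split => w /=; rewrite mul1g walkE// => -[].
pose V := incr_at (iota 0 n).
have mV B : measurable (V @^-1` B) by exact/measurable_incr_at/iota_uniq.
rewrite (_ : _ `&` _ = V @^-1` A `&` V @^-1` A); last by rewrite setTI setIid.
(* [V] lies in [A] with probability 0 as it does so on each of its atoms. *)
rewrite (@atomic_law_scale _ _ _ P _ (countable_seq L_countable) V V _ 0) ?mul0e//.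
move=> s; rewrite mul0e; have [As|nAs] := pselect (A s); last first.
  rewrite (_ : _ `&` _ = set0) ?measure0//; apply/seteqP; split => // w [Aw ws].
  by apply: nAs; rewrite -ws.
apply/eqP; rewrite eq_le measure_ge0 andbT.
have [sJ|/eqP sJ] := eqVneq (size s) (size (iota 0 n)); last first.
  by rewrite /V (incr_at_fiber0 sJ) setI0 measure0.
have [mF PF] := incr_at_fiber (iota_uniq 0 n) sJ.
apply: (@le_trans _ _ (P (V @^-1` [set s]))).
  apply: le_measure; rewrite ?inE//; exact: measurableI.
by rewrite PF lee_fin leNgt; apply/negP => ?; apply: nex; exists s.
Qed.

End Increments.

(** * Lasting fair lamp flips *)

Section LampFlip.
Variables (R : realType) (G : groupType) (mu : probability (lamplighter G) R).
Implicit Types (s u r : seq (lamplighter G)) (x y g : G).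

Lemma lmul_lamp (z z' : lamplighter G) x :
  (z * z')%g.1 x = z.1 x + z'.1 (z.2^-1 * x)%g.
Proof. by rewrite /= config_addE config_shiftE. Qed.

Lemma lmul_pos (z z' : lamplighter G) : (z * z')%g.2 = (z.2 * z'.2)%g.
Proof. by []. Qed.

(** Transposing the two factors of a word changes neither its length, nor its
    probability, nor, one of the displacements being trivial, its endpoint; but
    it moves the lamp that is switched from 1 to [g]. Taking two orders of the
    same letters avoids any parity obstruction: there may be no two words of
    equal length for the neutral element and for a single lamp switch. *)
Lemma fair_lamp_flip : infinite_set [set: G] ->
  (forall z, exists s, word_prod s = z /\ 0 < word_prob mu s) ->
  exists (v : bool -> seq (lamplighter G)) (g : G) (q : R), 0 < q /\
    forall b, [/\ size (v b) = size (v true), word_prob mu (v b) = q,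
      (word_prod (v b)).2 = g & (word_prod (v b)).1 1%g = b%:R].
Proof.
move=> Ginf words.
have [g g1] : exists g : G, g != 1%g.
  apply: contrapT => nog; apply: Ginf.
  apply: sub_finite_set (finite_set1 1%g) => x _ /=.
  by apply/eqP; apply: contrapT => /negP x1; apply: nog; exists x.
pose lamp1 : config G := [fsfun w in [fset 1%g]%fset => (1 : 'Z_2)].
have lamp1E x : lamp1 x = (x == 1%g)%:R.
  by rewrite /lamp1 fsfunE inE; case: eqP.
have [sa [sa1 sa0]] := words (lamp1, 1%g).
have [sg [sg1 sg0]] := words (config0 G, g).
exists (fun b => if b then sa ++ sg else sg ++ sa), g.
exists (word_prob mu sa * word_prob mu sg); split; first exact: mulr_gt0.
case; split => //.
- exact: word_prob_cat.
- by rewrite big_cat /= sa1 sg1 /= mul1g.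
- rewrite big_cat /= sa1 sg1 /= config_addE config_shiftE lamp1E config0E eqxx.
  by rewrite addr0.
- by rewrite !size_cat addnC.
- by rewrite word_prob_cat mulrC.
- by rewrite big_cat /= sa1 sg1 /= mulg1.
- rewrite big_cat /= sa1 sg1 /= config_addE config_shiftE lamp1E config0E mulg1.
  by rewrite add0r -[1%g]invg1 (inj_eq invg_inj) (negbTE g1).
Qed.

Definition avoids_from k x s :=
  forall j, (k <= j <= size s)%N -> (word_prod (take j s)).2 <> x.

Variables (v : bool -> seq (lamplighter G)) (g : G) (q : R) (m : nat).
Hypothesis q_ge0 : 0 <= q.
Hypothesis size_v : forall b, size (v b) = m.
Hypothesis prob_v : forall b, word_prob mu (v b) = q.
Hypothesis pos_v : forall b, (word_prod (v b)).2 = g.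
Hypothesis lamp_v : forall b, (word_prod (v b)).1 1%g = b%:R.

(** An attempt at time [t] that succeeds. Coming back to the position at time
    [t] is a displacement by [g^-1] after the word [v b], which has displaced
    the walker by [g]; returns less than [k] steps after the end of [v b] are
    harmless, since the next attempt starts only then. *)
Definition lasting_flip k t s := exists u b r,
  [/\ s = u ++ v b ++ r, size u = t, avoids_from k g^-1%g r &
      (word_prod s).1 (word_prod u).2 = 1].

Lemma lasting_flip_lamp k t s : lasting_flip k t s ->
  (word_prod (take t s)).2 \in finsupp (word_prod s).1.
Proof.
move=> [u [b [r [sE <- _ lit]]]]; rewrite sE take_size_cat// -sE mem_finsupp.
by rewrite lit.
Qed.

(** This is what makes the positions of successive lasting flips distinct. *)
Lemma lasting_flip_last k t j s : lasting_flip k t s ->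
  (t + m + k <= j <= size s)%N ->
  (word_prod (take j s)).2 <> (word_prod (take t s)).2.
Proof.
move=> [u [b [r [-> ut rg _]]]] /andP[tj]; rewrite catA.
have uvt : size (u ++ v b) = (t + m)%N by rewrite size_cat size_v ut.
rewrite size_cat uvt => js.
have -> : take j ((u ++ v b) ++ r) = (u ++ v b) ++ take (j - (t + m)) r.
  by rewrite take_cat uvt ltnNge (leq_trans (leq_addr k _) tj).
have -> : take t ((u ++ v b) ++ r) = u by rewrite -catA take_size_cat.
rewrite -catA !big_cat !lmul_pos pos_v.
rewrite -[X in _ = X]mulg1 => /mulgI gx.
apply: (rg (j - (t + m))%N); last by rewrite -(mulKg g (_.2)) gx mulg1.
rewrite leq_subRL ?tj ?leq_subLR//.
by rewrite (leq_trans _ tj)// leq_addr.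
Qed.

(** The map from the time of a lasting flip to the position at that time is
    injective when the times are spaced by [m + k], and its values are sites
    whose lamps are on. *)
Lemma count_lasting_flip k M s : size s = (M * (m + k))%N ->
  (\sum_(i < M) `[< lasting_flip k (i * (m + k)) s >] <=
     #|` finsupp (word_prod s).1|)%N.
Proof.
move=> sM; set K := (m + k)%N.
pose I := [seq i <- iota 0 M | `[< lasting_flip k (i * K) s >]].
have -> : (\sum_(i < M) `[< lasting_flip k (i * K) s >] = size I)%N.
  rewrite size_filter -sum1_count -[M in RHS]subn0 -/(index_iota 0 M).
  by rewrite big_mkord [RHS]big_mkcond; apply: eq_bigr => i _; case: asboolP.
pose y i := (word_prod (take (i * K) s)).2.
have uI : uniq I by rewrite filter_uniq// iota_uniq.
have main i j : i \in I -> j \in I -> (i < j)%N -> y j <> y i.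
  rewrite !mem_filter !mem_iota => /andP[/asboolP fi _] /and3P[_ _ jM] ij.
  apply: (lasting_flip_last fi); rewrite -addnA -/K -mulSnr leq_mul2r ij orbT /=.
  by rewrite sM leq_mul2r ltnW ?orbT.
have yI : {in I &, injective y}.
  move=> i j iI jI yij; have [ij|ji|//] := ltngtP i j.
    by case: (main _ _ iI jI ij).
  by case: (main _ _ jI iI ji).
rewrite -(size_map y); apply: uniq_leq_size; first by rewrite map_inj_in_uniq.
move=> _ /mapP[i + ->]; rewrite mem_filter => /andP[/asboolP fi _].
exact: lasting_flip_lamp fi.
Qed.

Context d (Omega : measurableType d) (P : probability Omega R).
Variable incr : nat -> {RV P >-> lamplighter G}.
Hypothesis incr_iid : iid incr mu.
Hypothesis L_countable : countable [set: lamplighter G].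

(** Split the increments into those before, during and after the flip. Given
    the outer ones, the final state of the lamp is a constant plus the state
    that [v b] leaves at its starting point, which is on for [v true] only; so
    exactly one [b] works, and the middle increments read [v b] with
    probability [q] independently of the outer ones. *)
Lemma prob_lasting_flip k t n :
  (q%:E * P (incr_at incr (iota 0 n) @^-1` avoids_from k g^-1%g) <=
   P (incr_at incr (iota 0 (t + (m + n))) @^-1` lasting_flip k t))%E.
Proof.
pose Jv := iota t m; pose Jr := iota (t + m) n; pose J := iota 0 t ++ Jr.
pose N := (t + (m + n))%N.
have iotaN : iota 0 N = iota 0 t ++ Jv ++ Jr by rewrite /N !iotaD.
have uN : uniq (Jv ++ J).
  by rewrite (@perm_uniq _ _ (iota 0 N)) ?iota_uniq// iotaN perm_catCA.
have uJ : uniq J by move: uN; rewrite cat_uniq => /and3P[].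
(* [A b] is the condition on the outer increments under which [v b] gives a
   lasting flip, and [E b] the event that it does. *)
pose A b : set (seq (lamplighter G)) := [set s |
  avoids_from k g^-1%g (drop t s) /\
  (word_prod (take t s ++ v b ++ drop t s)).1 (word_prod (take t s)).2 = 1].
pose E b := incr_at incr Jv @^-1` [set v b] `&` incr_at incr J @^-1` A b.
have mJ B : measurable (incr_at incr J @^-1` B).
  exact: (measurable_incr_at incr_iid).
have mE b : measurable (E b).
  apply: measurableI => //; apply: (measurable_incr_at incr_iid) => //.
  exact: iota_uniq.
have PE b : (P (E b) = q%:E * P (incr_at incr J @^-1` A b))%E.
  by rewrite -(prob_v b) (incr_at_indep incr_iid)// size_iota size_v.
apply: (@le_trans _ _ (P (E false `|` E true))); last first.
  apply: le_measure; rewrite ?inE.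
  - exact: measurableU.
  - by apply: (measurable_incr_at incr_iid); rewrite ?iota_uniq.
  have Esub b : E b `<=` incr_at incr (iota 0 N) @^-1` lasting_flip k t.
    move=> w [/= wv [avoid lit]].
    have wJ : incr_at incr J w = incr_at incr (iota 0 t) w ++ incr_at incr Jr w.
      by rewrite /incr_at map_cat.
    have st : size (incr_at incr (iota 0 t) w) = t by rewrite size_map size_iota.
    move: avoid lit; rewrite wJ take_size_cat// drop_size_cat// => avoid lit.
    have wN : incr_at incr (iota 0 N) w =
        incr_at incr (iota 0 t) w ++ v b ++ incr_at incr Jr w.
      by rewrite iotaN -wv /incr_at !map_cat.
    by exists (incr_at incr (iota 0 t) w), b, (incr_at incr Jr w); rewrite wN.
  by move=> w [] /Esub.
rewrite measureU//; last first.
  apply/seteqP; split => // w [[/= wf _] [wt _]].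
  have := lamp_v true; rewrite -wt wf lamp_v => /eqP.
  by [].
have -> : (P (E false) + P (E true) = q%:E *
    (P (incr_at incr J @^-1` A false) + P (incr_at incr J @^-1` A true)))%E.
  by rewrite !PE ge0_muleDr.
apply: lee_wpmul2l; first by rewrite lee_fin.
rewrite (incr_at_shift incr_iid L_countable (J' := Jr)) ?iota_uniq ?size_iota//.
apply: le_trans (measureU2 _ _ _) => //.
apply: le_measure; rewrite ?inE.
- by apply: (measurable_incr_at incr_iid); rewrite ?iota_uniq.
- exact: measurableU.
move=> w /= avoid.
have wJ : incr_at incr J w = incr_at incr (iota 0 t) w ++ incr_at incr Jr w.
  by rewrite /incr_at map_cat.
have st : size (incr_at incr (iota 0 t) w) = t by rewrite size_map size_iota.
(* The state of the lamp due to the outer increments. *)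
pose a : 'Z_2 :=
  (word_prod (incr_at incr (iota 0 t) w)).1
    (word_prod (incr_at incr (iota 0 t) w)).2
  + (word_prod (incr_at incr Jr w)).1 g^-1%g.
have lampE b :
    (word_prod (incr_at incr (iota 0 t) w ++ v b ++ incr_at incr Jr w)).1
      (word_prod (incr_at incr (iota 0 t) w)).2 = a + b%:R.
  by rewrite !big_cat !lmul_lamp mulVg lamp_v pos_v mulg1 addrAC addrA.
rewrite /setU /= /A /= wJ take_size_cat// drop_size_cat// !lampE.
have [->|->] : a = 0 \/ a = 1.
- by case: (a) => [[|[|[]]]]// ?; [left|right]; apply: val_inj.
- by right; rewrite add0r.
- by left; rewrite addr0.
Qed.

(** The events of avoiding [x] from time [k] on increase with [k] to an event
    of probability 1, so one of them has probability more than 1/2. *)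
Lemma escape_time x : transient P (fun n w => (walk incr n w).2) ->
  exists k, forall n,
    (2^-1%:E <= P (incr_at incr (iota 0 n) @^-1` avoids_from k x))%E.
Proof.
move=> /(_ x) trans.
have mX n : measurable [set w | (walk incr n w).2 <> x].
  rewrite (_ : [set w | _] =
      incr_at incr (iota 0 n) @^-1`
        [set s : seq (lamplighter G) | (word_prod s).2 <> x]).
    by apply: (measurable_incr_at incr_iid); rewrite ?iota_uniq.
  by apply/seteqP; split => w /=; rewrite walkE.
pose F k := \bigcap_(n in [set n | (k <= n)%N]) [set w | (walk incr n w).2 <> x].
have mF k : measurable (F k) by apply: bigcap_measurableType => n _.
have mUF : measurable (\bigcup_k F k) by apply: bigcup_measurable.
have ndF : nondecreasing_seq F.
  move=> k k' kk'; apply/subsetPset => w Fw n /= k'n; apply: Fw => /=.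
  exact: leq_trans k'n.
have PF : P (\bigcup_k F k) = 1%E.
  have [N [mN PN subN]] := trans.
  apply/eqP; rewrite eq_le probability_le1//=.
  have : (P (~` N) <= P (\bigcup_k F k))%E.
    apply: le_measure; rewrite ?inE//; first exact: measurableC.
    move=> w Nw; have : ~ (~ \forall n \near \oo, (walk incr n w).2 <> x).
      by move=> /subN.
    by move=> /contrapT[k _ kF]; exists k => // n /=; exact: kF.
  by rewrite probability_setC// PN sube0.
have [k Fk] : exists k, (2^-1%:E < P (F k))%E.
  have cvgF : P \o F @ \oo --> 1%E by rewrite -PF; exact: nondecreasing_cvg_mu.
  have : \forall k \near \oo, (2^-1%:E < P (F k))%E.
    apply: (cvgF [set y | (2^-1%:E < y)%E]).
    apply: (open_ereal_gt' (x := 1%E)).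
    by rewrite lte_fin invf_lt1// ltr1n.
  by move=> [k _ kF]; exists k; apply: kF => /=.
exists k => n; apply: (le_trans (ltW Fk)); apply: le_measure; rewrite ?inE//.
  by apply: (measurable_incr_at incr_iid); rewrite ?iota_uniq.
move=> w Fw j; rewrite size_map size_iota => /andP[kj jn].
have -> : take j (incr_at incr (iota 0 n) w) = incr_at incr (iota 0 j) w.
  by rewrite /incr_at -map_take take_iota (minn_idPl jn).
by rewrite -walkE; exact: Fw.
Qed.

End LampFlip.

(** * Frequencies of likely events *)

Section FrequentEvents.
Context d (Omega : measurableType d) (R : realType) (P : probability Omega R).

(** The fraction of the first [M] events that occur lies in [0, 1] and has
    expectation at least [a]; if [L] were not positive it would tend to 0 almost
    surely, hence in expectation, by dominated convergence. *)
Lemma frequent_events_limit_gt0 (D : nat -> nat -> set Omega)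
    (U : nat -> Omega -> R) (a L : R) :
  (forall M i, (i < M)%N -> measurable (D M i)) -> 0 < a ->
  (forall M i, (i < M)%N -> (a%:E <= P (D M i))%E) ->
  (forall M w, \sum_(i < M) \1_(D M i) w <= U M w) ->
  {ae P, forall w, (fun M => U M w / M%:R) @ \oo --> L} -> 0 < L.
Proof.
move=> mD a0 aD DU UL; rewrite ltNge; apply/negP => L0.
pose f M w : R := M%:R^-1 * \sum_(i < M) \1_(D M i) w.
have f_ge0 M w : 0 <= f M w by rewrite mulr_ge0// sumr_ge0.
have f_le1 M w : f M w <= 1.
  case: M => [|M]; first by rewrite /f invr0 mul0r ler01.
  rewrite /f mulrC ler_pdivrMr// mul1r -[M.+1 in leRHS]card_ord.
  rewrite -sum1_card natr_sum.
  by apply: ler_sum => i _; rewrite indicE; case: (_ \in _).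
have mf M : measurable_fun setT (f M).
  apply: measurable_funM; first exact: measurable_cst.
  apply: measurable_sum => i; apply: measurable_indic.
  exact: mD.
have f0 : {ae P, forall w, setT w -> (fun M => (f M w)%:E) @ \oo --> 0%E}.
  apply: filterS UL => w UL _; apply: cvg_EFin; first exact: nearW.
  have UM0 M : 0 <= U M w / M%:R.
    by rewrite divr_ge0// (le_trans _ (DU M w))// sumr_ge0.
  have L_0 : L = 0.
    apply/eqP; rewrite eq_le L0 /=; rewrite -(cvg_lim _ UL)//.
    by apply: limr_ge; [apply/cvg_ex; exists L|exact: nearW].
  move: UL; rewrite L_0; apply: squeeze_cvgr; last exact: cvg_cst.
  near=> M; rewrite f_ge0 /= /f mulrC ler_wpM2r// invr_ge0//.
have int1 : P.-integrable setT (cst 1%E : Omega -> \bar R).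
  exact: (finite_measure_integrable_cst P 1).
have f_dom : {ae P, forall w M, setT w ->
    (`|(f M w)%:E| <= (cst 1 : Omega -> \bar R) w)%E}.
  by apply: aeW => w M _; rewrite /= lee_fin ger0_norm.
have [_ _] := @dominated_convergence _ _ _ P setT measurableT
  (fun M w => (f M w)%:E) (cst 0%E) (cst 1%E)
  (fun M => (measurable_EFinP _ _).2 (mf M)) (measurable_cst _) f0 int1 f_dom.
rewrite integral0 => int0.
have int_ge M : (0 < M)%N -> (a%:E <= \int[P]_w (f M w)%:E)%E.
  move=> M0.
  have -> : (\int[P]_w (f M w)%:E = (M%:R^-1)%:E * \sum_(i < M) P (D M i))%E.
    under eq_integral do rewrite EFinM -sumEFin.
    rewrite ge0_integralZl//=.
    - rewrite ge0_integral_sum//=.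
      + congr (_ * _)%E; apply: eq_bigr => i _.
        by rewrite integral_indic// ?setIT//; exact: mD.
      + by move=> i; apply/measurable_EFinP/measurable_indic/mD.
    - apply: emeasurable_sum => i; by apply/measurable_EFinP/measurable_indic/mD.
    - by move=> w _; apply: sume_ge0.
  have -> : a%:E = ((M%:R^-1)%:E * \sum_(i < M) a%:E)%E.
    rewrite sumEFin sumr_const card_ord -EFinM -[a *+ M]mulr_natl mulKf// pnatr_eq0.
    by rewrite -lt0n.
  apply: lee_wpmul2l; first by rewrite lee_fin.
  by apply: lee_sum => i _; exact: aD.
have : (a%:E <= 0)%E.
  rewrite -(cvg_lim _ int0)//; apply: lime_ge; first by apply/cvg_ex; exists 0%E.
  by near=> M; apply: int_ge; near: M; exact: nbhs_infty_gt.
by rewrite lee_fin leNgt a0.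
Unshelve. all: by end_near.
Qed.

End FrequentEvents.

(** * Tours are at least as long as distances *)

Section DistanceBound.
Variables (R : realType) (G : groupType) (S : {fset G}) (l : G -> R).
Hypothesis l_gt0 : forall s, s \in S -> 0 < l s.
Hypothesis S_gen : generates_as_semigroup S.

Lemma prod_steps (x : G) p : (x * \prod_(a <- steps x p) a)%g = last x p.
Proof.
elim: p x => [|y p IHp] x; first by rewrite /steps /= big_nil mulg1.
by rewrite /steps /= big_cons mulgA mulVKg IHp.
Qed.

Lemma sub_steps (x : G) p : is_path S x p -> {subset steps x p <= S}.
Proof.
elim: p x => [//|y p IHp] x /= /andP[xy /IHp sub] a.
by rewrite inE => /predU1P[->//|/sub].
Qed.

Lemma dist_le_dTS (z : lamplighter G) : dist S l 1%g z.2 <= dTS S l z.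
Proof.
have [p [[pS pz _ <-] _]] := dTSP l_gt0 S_gen z.
have [s [_ _ _ smin]] := distP l_gt0 S_gen 1%g z.2.
by apply: smin; [exact: sub_steps|rewrite prod_steps].
Qed.

End DistanceBound.

(** * Positive density of lamps and the speed gap *)

Theorem theorem3p3 (R : realType)
  (G : groupType) (S : {fset G}) (l : G -> R)
  (G_infinite : infinite_set [set: G])
  (S_no1 : 1%g \notin S)
  (S_sym : forall s, s \in S -> (s^-1)%g \in S)
  (S_gen : generates_as_semigroup S)
  (l_gt0 : forall s, s \in S -> 0 < l s)
  (l_sym : forall s, s \in S -> l s = l (s^-1)%g)
  (c : R) (c_ge0 : 0 <= c)
  (d : measure_display) (Omega : measurableType d) (P : probability Omega R)
  (mu : probability (lamplighter G) R)
  (incr : nat -> {RV P >-> lamplighter G})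
  (incr_iid : iid incr mu)
  (mu_gen : generated_subgroup (mass_support mu) = [set: lamplighter G])
  (mu_range : exists2 rad : R, 0 <= rad &
     forall z : lamplighter G, mass_support mu z ->
       forall y, y \in finsupp z.1 -> dist S l 1%g y <= rad)
  (mu_moment :
     (\esum_(z in [set: lamplighter G])
        ((dist S l 1%g z.2)%:E * mu [set z]) < +oo)%E)
  (Z_irreducible : irreducible P (walk incr))
  (Z_transient : transient P (walk incr))
  (X_transient : transient P (fun n w => (walk incr n w).2))
  (ell0 ell ell_supp : R)
  (ell0E : as_limit P
     (fun n w => dist S l 1%g (walk incr n w).2 / n%:R) ell0)
  (ellE : as_limit P
     (fun n w => ell_length S l c (walk incr n w) / n%:R) ell)
  (ell_suppE : as_limit P
     (fun n w => #|` finsupp (walk incr n w).1|%:R / n%:R) ell_supp) :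
  0 < ell_supp /\ (0 < c -> ell0 < ell).
Proof.
have Lc := countable_lamplighter S_gen.
have supp_gt0 : 0 < ell_supp.
  have [v [g [q [q0 vP]]]] := fair_lamp_flip G_infinite
    (fun z => word_prob_gt0 incr_iid Lc z Z_irreducible).
  set m := size (v true) in vP.
  have size_v b : size (v b) = m by have [] := vP b.
  have prob_v b : word_prob mu (v b) = q by have [] := vP b.
  have pos_v b : (word_prod (v b)).2 = g by have [] := vP b.
  have lamp_v b : (word_prod (v b)).1 1%g = b%:R by have [] := vP b.
  have m_gt0 : (0 < m)%N.
    rewrite lt0n; apply/negP => /eqP m0; have /eqP := lamp_v true.
    by rewrite (size0nil m0) big_nil /= config0E.
  have [k kP] := @escape_time _ _ _ _ _ _ _ incr_iid Lc g^-1%g X_transient.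
  set K := (m + k)%N; have K_gt0 : (0 < K)%N by rewrite addn_gt0 m_gt0.
  (* The [i]-th of [M] attempts succeeds, within [M * K] steps. *)
  pose D M i := incr_at incr (iota 0 (M * K)) @^-1` lasting_flip v g k (i * K).
  pose U M w : R := #|` finsupp (walk incr (M * K) w).1|%:R.
  (* Sampling every [K] steps multiplies the limit by [K]. *)
  rewrite -(pmulr_lgt0 (x := K%:R)) ?ltr0n//.
  apply: (@frequent_events_limit_gt0 _ Omega R P D U (q * 2^-1)).
  - by move=> M i _; apply: (measurable_incr_at incr_iid); rewrite ?iota_uniq.
  - by rewrite divr_gt0.
  - move=> M i iM.
    have MK : (M * K = i * K + (m + ((M - i.+1) * K + k)))%N.
      by rewrite [(m + _)%N]addnCA -mulSnr -mulnDl subnSK// subnKC// ltnW.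
    rewrite /D MK.
    apply: le_trans (prob_lasting_flip (ltW q0) size_v prob_v pos_v lamp_v
      incr_iid Lc k (i * K) _).
    by rewrite EFinM; apply: lee_wpmul2l => //; rewrite lee_fin ltW.
  - move=> M w; rewrite /U walkE.
    have sMK : size (incr_at incr (iota 0 (M * K)) w) = (M * K)%N.
      by rewrite size_map size_iota.
    have := count_lasting_flip size_v pos_v sMK; rewrite -(ler_nat R) natr_sum.
    apply: le_trans; apply: ler_sum => i _; rewrite indicE /D.
    by rewrite ler_nat; case: asboolP => nf; [exact: leq_b1|rewrite memNset].
  - apply: filterS ell_suppE => w suppE.
    have MK_oo : (fun M => M * K)%N @ \oo --> \oo.
      apply/cvgnyPge => A; near=> M; apply: leq_trans (leq_pmulr _ K_gt0).
      by near: M; exact: nbhs_infty_ge.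
    have : (fun M => U M w / (M * K)%:R * K%:R) @ \oo --> ell_supp * K%:R.
      by apply: cvgMr_tmp; exact: cvg_comp MK_oo suppE.
    apply: cvg_trans; apply: near_eq_cvg; apply: nearW => M /=.
    by rewrite natrM invfM mulrA mulfVK// pnatr_eq0 -lt0n.
split=> // c_gt0.
have [w [[w0 wl] ws]] : exists w,
  ((fun n => dist S l 1%g (walk incr n w).2 / n%:R) @ \oo --> ell0 /\
   (fun n => ell_length S l c (walk incr n w) / n%:R) @ \oo --> ell) /\
  (fun n => #|` finsupp (walk incr n w).1|%:R / n%:R : R) @ \oo --> ell_supp.
  have ae_proper : ProperFilter (almost_everywhere P).
    apply: ae_properfilter_algebraOfSetsType.
    by rewrite [X in (_ < X)%E]probability_setT.
  apply: (@filter_ex _ (almost_everywhere P)).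
  by apply: filterI => //; apply: filterI.
suff : ell0 + c * ell_supp <= ell by apply: lt_le_trans; rewrite ltrDl mulr_gt0.
apply: ler_cvg_to (cvgD w0 (cvgMl_tmp (a := c) ws)) wl _; apply: nearW => n /=.
rewrite /ell_length mulrDl -mulrA; apply: lerD => //.
by rewrite ler_wpM2r ?invr_ge0//; exact: dist_le_dTS.
Unshelve. all: by end_near.
Qed.
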